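(* Let $m,n\ge0$ be integers with $m+n\ge1$ and let $k\ge 1$. Let $T_{\gamma_k}=T_1T_2\cdots T_{k-1}$ in the Iwahori-Hecke algebra $\mathscr{H}_{K',k}(q)$ (so $T_{\gamma_1}=1$). Then $$\operatorname{tr}\big(D_k\,\pi_k(T_{\gamma_k})\big)=\frac{q^k}{q-q^{-1}}\,q_k(x/y;q^{-2}),$$ where the trace is taken on $V^{\otimes k}$.
   Context: Here $q,x_1,\dots,x_m,y_1,\dots,y_n$ are algebraically independent indeterminates over $\mathbb{Q}$, and $K'=\mathbb{Q}(q)(x_1,\dots,x_m,y_1,\dots,y_n)$. $\mathscr{H}_{K',k}(q)$ is the $K'$-algebra generated by $T_1,\dots,T_{k-1}$ with relations $T_i^2=(q-q^{-1})T_i+1$; $T_iT_{i+1}T_i=T_{i+1}T_iT_{i+1}$; $T_iT_j=T_jT_i$ if $|i-j|>1$. $V$ is the $K'$-vector space with basis $v_1,\dots,v_{m+n}$, with $|v_a|=0$ for $a\le m$ and $|v_a|=1$ for $a>m$. Let $T$ be the operator on $V\otimes V$ given by $T(v_a\otimes v_b)=\frac{(-1)^{|v_a|}(q+q^{-1})+q-q^{-1}}{2}\,v_a\otimes v_b$ if $a=b$; $T(v_a\otimes v_b)=(-1)^{|v_a||v_b|}v_b\otimes v_a+(q-q^{-1})v_a\otimes v_b$ if $a<b$; $T(v_a\otimes v_b)=(-1)^{|v_a||v_b|}v_b\otimes v_a$ if $a>b$. The representation $\pi_k$ of $\mathscr{H}_{K',k}(q)$ on $V^{\otimes k}$ is $\pi_k(T_i)=\operatorname{Id}^{\otimes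 (i-1)}\otimes T\otimes \operatorname{Id}^{\otimes (k-i-1)}$. Put $z_i=x_i$ for $1\le i\le m$ and $z_{m+j}=-y_j$ for $1\le j\le n$. $D_k$ is the diagonal operator on $V^{\otimes k}$ with $D_k(v_{i_1}\otimes\cdots\otimes v_{i_k})=z_{i_1}\cdots z_{i_k}\,v_{i_1}\otimes\cdots\otimes v_{i_k}$. The supersymmetric functions $q_k(x/y;q)$ are defined by $\sum_{k\ge0}q_k(x/y;q)u^k=\prod_{i=1}^m\frac{1-x_iqu}{1-x_iu}\prod_{j=1}^n\frac{1-y_ju}{1-y_jqu}$; $q_k(x/y;q^{-2})$ is obtained by replacing the parameter $q$ by $q^{-2}$. *)

(* Defs.v *)
From HB Require Import structures.
From mathcomp Require Import all_boot all_order all_algebra.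
From mathcomp Require Import generic_quotient mpoly boolp ring zify.

Set Implicit Arguments.
Unset Strict Implicit.
Unset Printing Implicit Defensive.

Import GRing.Theory.

Local Open Scope ring_scope.
Local Open Scope quotient_scope.

(* Unital associative algebras by generators and relations: formal            *)
(* expressions in the generators, modulo the least congruence that contains   *)
(* the relations and makes the quotient an F-algebra.                         *)
Inductive aterm (F X : Type) : Type :=
  | AScal of F
  | AGen of X
  | AAdd of aterm F X & aterm F X
  | AMul of aterm F X & aterm F X.

Arguments AScal {F X} _.
Arguments AGen {F X} _.

HB.instance Definition _ (F X : Type) := gen_eqMixin (aterm F X).
HB.instance Definition _ (F X : Type) := gen_choiceMixin (aterm F X).

Section Presentation.

Variables (F : comNzRingType) (X : Type).
Notation term := (aterm F X).
Variable rel : term -> term -> Prop.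

Inductive acong : term -> term -> Prop :=
  | acong_rel s t : rel s t -> acong s t
  | acong_refl t : acong t t
  | acong_sym s t : acong s t -> acong t s
  | acong_trans s t u : acong s t -> acong t u -> acong s u
  | acong_add s s' t t' :
      acong s s' -> acong t t' -> acong (AAdd s t) (AAdd s' t')
  | acong_mul s s' t t' :
      acong s s' -> acong t t' -> acong (AMul s t) (AMul s' t')
  | acong_addA s t u : acong (AAdd s (AAdd t u)) (AAdd (AAdd s t) u)
  | acong_addC s t : acong (AAdd s t) (AAdd t s)
  | acong_add0 t : acong (AAdd (AScal 0) t) t
  | acong_addN t : acong (AAdd (AMul (AScal (-1)) t) t) (AScal 0)
  | acong_mulA s t u : acong (AMul s (AMul t u)) (AMul (AMul s t) u)
  | acong_mul1 t : acong (AMul (AScal 1) t) t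
  | acong_mulDl s t u :
      acong (AMul (AAdd s t) u) (AAdd (AMul s u) (AMul t u))
  | acong_mulDr s t u :
      acong (AMul s (AAdd t u)) (AAdd (AMul s t) (AMul s u))
  | acong_scalD a b : acong (AScal (a + b)) (AAdd (AScal a) (AScal b))
  | acong_scalM a b : acong (AScal (a * b)) (AMul (AScal a) (AScal b))
  | acong_scalC a t : acong (AMul (AScal a) t) (AMul t (AScal a)).

Definition acongb (s t : term) : bool := `[< acong s t >].

Fact acongb_refl : reflexive acongb.
Proof. by move=> t; apply/asboolP; exact: acong_refl. Qed.

Fact acongb_sym : ssrbool.symmetric acongb.
Proof.
by move=> s t; apply/asboolP/asboolP; exact: acong_sym.
Qed.

Fact acongb_trans : transitive acongb.
Proof.
by move=> t s u /asboolP st /asboolP tu; apply/asboolP; exact: acong_trans st tu.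
Qed.

Canonical acong_equiv := EquivRel acongb acongb_refl acongb_sym acongb_trans.

Definition presented := {eq_quot acong_equiv}.

HB.instance Definition _ : EqQuotient _ acong_equiv presented :=
  EqQuotient.on presented.
HB.instance Definition _ := Choice.on presented.

Definition pclass (t : term) : presented := \pi_presented t.

Lemma pclassP s t : (pclass s = pclass t) <-> acong s t.
Proof.
split=> [st|st]; last by apply/eqmodP/asboolP.
by apply/asboolP; move/eqmodP: st.
Qed.

Lemma pclass_reprK (x : presented) : pclass (repr x) = x.
Proof. exact: reprK. Qed.

Lemma pclassW (P : presented -> Prop) :
  (forall t, P (pclass t)) -> forall x, P x.
Proof. by move=> Pt x; rewrite -[x]pclass_reprK. Qed.

Lemma acong_repr t : acong (repr (pclass t)) t.
Proof. by apply/pclassP; rewrite pclass_reprK. Qed.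

Definition padd (x y : presented) := pclass (AAdd (repr x) (repr y)).
Definition pmul (x y : presented) := pclass (AMul (repr x) (repr y)).
Definition popp (x : presented) := pclass (AMul (AScal (-1)) (repr x)).
Definition pscale (a : F) (x : presented) := pclass (AMul (AScal a) (repr x)).

Lemma paddE s t : padd (pclass s) (pclass t) = pclass (AAdd s t).
Proof. by apply/pclassP/acong_add; exact: acong_repr. Qed.

Lemma pmulE s t : pmul (pclass s) (pclass t) = pclass (AMul s t).
Proof. by apply/pclassP/acong_mul; exact: acong_repr. Qed.

Lemma pscaleE a t : pscale a (pclass t) = pclass (AMul (AScal a) t).
Proof.
by apply/pclassP/acong_mul; [exact: acong_refl|exact: acong_repr].
Qed.

Lemma poppE t : popp (pclass t) = pclass (AMul (AScal (-1)) t).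
Proof. exact: pscaleE. Qed.

Fact paddA : associative padd.
Proof.
elim/pclassW=> s; elim/pclassW=> t; elim/pclassW=> u.
by rewrite !paddE; apply/pclassP/acong_addA.
Qed.

Fact paddC : commutative padd.
Proof.
elim/pclassW=> s; elim/pclassW=> t.
by rewrite !paddE; apply/pclassP/acong_addC.
Qed.

Fact padd0 : left_id (pclass (AScal 0)) padd.
Proof. by elim/pclassW=> t; rewrite !paddE; apply/pclassP/acong_add0. Qed.

Fact paddN : left_inverse (pclass (AScal 0)) popp padd.
Proof.
by elim/pclassW=> t; rewrite poppE paddE; apply/pclassP/acong_addN.
Qed.

HB.instance Definition _ := GRing.isZmodule.Build presented paddA paddC padd0 paddN.

Fact pmulA : associative pmul.
Proof.
elim/pclassW=> s; elim/pclassW=> t; elim/pclassW=> u.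
by rewrite !pmulE; apply/pclassP/acong_mulA.
Qed.

Fact pmul1l : left_id (pclass (AScal 1)) pmul.
Proof. by elim/pclassW=> t; rewrite !pmulE; apply/pclassP/acong_mul1. Qed.

Fact pmul1r : right_id (pclass (AScal 1)) pmul.
Proof.
elim/pclassW=> t; rewrite !pmulE; apply/pclassP.
exact: acong_trans (acong_sym (acong_scalC _ _)) (acong_mul1 _).
Qed.

Fact pmulDl : left_distributive pmul padd.
Proof.
elim/pclassW=> s; elim/pclassW=> t; elim/pclassW=> u.
by rewrite !(pmulE, paddE); apply/pclassP/acong_mulDl.
Qed.

Fact pmulDr : right_distributive pmul padd.
Proof.
elim/pclassW=> s; elim/pclassW=> t; elim/pclassW=> u.
by rewrite !(pmulE, paddE); apply/pclassP/acong_mulDr.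
Qed.

HB.instance Definition _ :=
  GRing.Zmodule_isPzRing.Build presented pmulA pmul1l pmul1r pmulDl pmulDr.

Fact pscaleA a b x : pscale a (pscale b x) = pscale (a * b) x.
Proof.
elim/pclassW: x => t; rewrite !pscaleE; apply/pclassP.
apply: acong_trans (acong_mulA _ _ _) _.
by apply: acong_mul (acong_refl _); apply/acong_sym/acong_scalM.
Qed.

Fact pscale1 : left_id 1 pscale.
Proof. by elim/pclassW=> t; rewrite pscaleE; apply/pclassP/acong_mul1. Qed.

Fact pscaleDr : right_distributive pscale +%R.
Proof.
move=> a; elim/pclassW=> s; elim/pclassW=> t.
rewrite [pclass s + _]paddE !pscaleE [RHS]paddE.
by apply/pclassP/acong_mulDr.
Qed.

Fact pscaleDl x : {morph pscale^~ x : a b / a + b}.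
Proof.
elim/pclassW: x => t a b; rewrite !pscaleE [RHS]paddE; apply/pclassP.
apply: acong_trans (acong_mulDl _ _ _).
by apply: acong_mul (acong_refl _); exact: acong_scalD.
Qed.

HB.instance Definition _ :=
  GRing.Zmodule_isLmodule.Build F presented pscaleA pscale1 pscaleDr pscaleDl.

(* MathComp's lalgType and algType require 1 != 0, which a presentation alone *)
(* does not give: the algebra structure is the ring and module structures     *)
(* together with pscaleAl and pscaleAr.                                       *)
Lemma pscaleAl a (x y : presented) : a *: (x * y) = (a *: x) * y.
Proof.
elim/pclassW: x => s; elim/pclassW: y => t.
rewrite [_ * _]pmulE [LHS]pscaleE [a *: _]pscaleE [RHS]pmulE.
by apply/pclassP/acong_mulA.
Qed.

Lemma pscaleAr a (x y : presented) : a *: (x * y) = x * (a *: y).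
Proof.
elim/pclassW: x => s; elim/pclassW: y => t.
rewrite [_ * pclass _]pmulE [LHS]pscaleE [a *: _]pscaleE [RHS]pmulE.
apply/pclassP.
apply: acong_trans (acong_mulA _ _ _) _.
apply: acong_trans (acong_sym (acong_mulA _ _ _)).
by apply: acong_mul (acong_refl _); exact: acong_scalC.
Qed.

Definition pgen (x : X) : presented := pclass (AGen x).

Section Lift.

Variables (N : nat) (g : X -> 'M[F]_N).

Fixpoint aeval (t : term) : 'M[F]_N :=
  match t with
  | AScal a => a%:M
  | AGen x => g x
  | AAdd s t => aeval s + aeval t
  | AMul s t => aeval s *m aeval t
  end.

Hypothesis g_rel : forall s t, rel s t -> aeval s = aeval t.

Lemma aeval_acong s t : acong s t -> aeval s = aeval t.
Proof.
elim=> {s t} //=.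
- by move=> s t u _ -> _ ->.
- by move=> s s' t t' _ -> _ ->.
- by move=> s s' t t' _ -> _ ->.
- by move=> *; rewrite addrA.
- by move=> *; rewrite addrC.
- by move=> *; rewrite raddf0 add0r.
- by move=> t; rewrite mul_scalar_mx scaleN1r addNr raddf0.
- by move=> *; rewrite mulmxA.
- by move=> *; rewrite mul1mx.
- by move=> *; rewrite mulmxDl.
- by move=> *; rewrite mulmxDr.
- by move=> *; rewrite raddfD.
- by move=> *; rewrite scalar_mxM.
- by move=> *; rewrite scalar_mxC.
Qed.

Definition plift of (forall s t, rel s t -> aeval s = aeval t) :=
  fun x : presented => aeval (repr x).

Local Notation lift := (plift g_rel).

Lemma pliftE t : lift (pclass t) = aeval t.
Proof. by apply: aeval_acong; exact: acong_repr. Qed.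

Fact plift_is_zmod_morphism : zmod_morphism lift.
Proof.
elim/pclassW=> s; elim/pclassW=> t.
by rewrite [- _]poppE [pclass s + _]paddE !pliftE /= mul_scalar_mx scaleN1r.
Qed.

Fact plift_is_monoid_morphism : monoid_morphism lift.
Proof.
split; first by rewrite [1]/(pclass _) pliftE.
by elim/pclassW=> s; elim/pclassW=> t; rewrite [_ * _]pmulE !pliftE.
Qed.

Fact plift_is_scalable : scalable lift.
Proof.
move=> a; elim/pclassW=> t.
by rewrite [a *: _]pscaleE !pliftE /= mul_scalar_mx.
Qed.

HB.instance Definition _ :=
  GRing.isZmodMorphism.Build presented 'M[F]_N lift plift_is_zmod_morphism.
HB.instance Definition _ :=
  GRing.isMonoidMorphism.Build presented 'M[F]_N lift plift_is_monoid_morphism.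
HB.instance Definition _ :=
  GRing.isScalable.Build F presented 'M[F]_N *:%R lift plift_is_scalable.

Lemma plift_gen x : lift (pgen x) = g x.
Proof. exact: pliftE. Qed.

End Lift.

End Presentation.

(* The generators T_1, ..., T_(k-1) are indexed from 0 by 'I_k.-1.            *)
Section Hecke.

Variables (F : fieldType) (q : F) (k : nat).
Notation T i := (@AGen F 'I_k.-1 i).

Inductive hecke_rel : aterm F 'I_k.-1 -> aterm F 'I_k.-1 -> Prop :=
  | hecke_quad i :
      hecke_rel (AMul (T i) (T i)) (AAdd (AMul (AScal (q - q^-1)) (T i)) (AScal 1))
  | hecke_braid (i j : 'I_k.-1) of j = i.+1 :> nat :
      hecke_rel (AMul (AMul (T i) (T j)) (T i)) (AMul (AMul (T j) (T i)) (T j))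
  | hecke_comm (i j : 'I_k.-1) of (i.+1 < j)%N || (j.+1 < i)%N :
      hecke_rel (AMul (T i) (T j)) (AMul (T j) (T i)).

Definition hecke := presented hecke_rel.

HB.instance Definition _ := GRing.PzRing.on hecke.
HB.instance Definition _ := GRing.Lmodule.on hecke.

Definition heckeT (i : 'I_k.-1) : hecke := pgen hecke_rel i.

Definition heckeT_gamma : hecke := \prod_(i < k.-1) heckeT i.

Lemma heckeT_quad i : heckeT i * heckeT i = (q - q^-1) *: heckeT i + 1.
Proof.
rewrite [_ * _]pmulE [_ *: _]pscaleE [RHS]paddE.
exact/pclassP/acong_rel/hecke_quad.
Qed.

Lemma heckeT_braid (i j : 'I_k.-1) : j = i.+1 :> nat ->
  heckeT i * heckeT j * heckeT i = heckeT j * heckeT i * heckeT j.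
Proof.
move=> ij; rewrite [_ i * _ j]pmulE [_ j * _ i]pmulE [LHS]pmulE [RHS]pmulE.
exact/pclassP/acong_rel/hecke_braid.
Qed.

Lemma heckeT_comm (i j : 'I_k.-1) : (i.+1 < j)%N || (j.+1 < i)%N ->
  heckeT i * heckeT j = heckeT j * heckeT i.
Proof.
move=> ij; rewrite [LHS]pmulE [RHS]pmulE.
exact/pclassP/acong_rel/hecke_comm.
Qed.

End Hecke.

(* The vector space with basis I is {ffun I -> F^o}; an endomorphism is given *)
(* by the images of the basis vectors, and its matrix acts on columns.        *)
Section Operators.

Variables (F : fieldType) (I : finType).

Definition bvec (s : I) : {ffun I -> F^o} := [ffun u => (u == s)%:R].

Definition opmx (f : I -> {ffun I -> F^o}) : 'M[F]_#|I| :=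
  \matrix_(r, c) f (enum_val c) (enum_val r).

Definition lext (f : I -> {ffun I -> F^o}) (v : {ffun I -> F^o}) :
  {ffun I -> F^o} := \sum_s v s *: f s.

Lemma lext_bvec f s : lext f (bvec s) = f s.
Proof.
rewrite /lext (bigD1 s) //= big1 => [|t /negPf ts]; rewrite ffunE ?ts ?scale0r //.
by rewrite eqxx scale1r addr0.
Qed.

Lemma lextD f v w : lext f (v + w) = lext f v + lext f w.
Proof.
rewrite /lext -big_split; apply: eq_bigr => s _ /=.
by rewrite -scalerDl ffunE.
Qed.

Lemma lextZ f a v : lext f (a *: v) = a *: lext f v.
Proof.
rewrite /lext scaler_sumr; apply: eq_bigr => s _.
by rewrite scalerA ffunE.
Qed.

Lemma opmx_mul f g : opmx f *m opmx g = opmx (fun s => lext f (g s)).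
Proof.
apply/matrixP=> r c; rewrite !mxE sum_ffunE.
transitivity (\sum_(s in I) f s (enum_val r) * g (enum_val c) s).
  rewrite [RHS]big_enum_val /=.
  by apply: eq_bigr => j _; rewrite !mxE.
by apply: eq_big => // s _; rewrite !ffunE mulrC.
Qed.

Lemma opmx1 : opmx bvec = 1%:M.
Proof.
by apply/matrixP=> r c; rewrite !mxE ffunE (inj_eq enum_val_inj).
Qed.

Lemma opmxD f g : opmx f + opmx g = opmx (fun s => f s + g s).
Proof. by apply/matrixP=> r c; rewrite !mxE !ffunE. Qed.

Lemma opmxZ a f : a *: opmx f = opmx (fun s => a *: f s).
Proof. by apply/matrixP=> r c; rewrite !mxE !ffunE. Qed.

Lemma eq_opmx f g : f =1 g -> opmx f = opmx g.
Proof. by move=> fg; apply/matrixP=> r c; rewrite !mxE fg. Qed.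

End Operators.

(* The basis of V is indexed from 0 by 'I_(m + n), and that of V^{\otimes k}   *)
(* is v_(s 0) \otimes ... \otimes v_(s (k-1)), s : {ffun 'I_k -> 'I_(m + n)}.  *)
Section TensorPower.

Variables (F : fieldType) (m n k : nat).
Notation N := (m + n)%N.
Notation tidx := {ffun 'I_k -> 'I_N}.

Lemma posr_subproof (i : 'I_k.-1) : (i.+1 < k)%N.
Proof. by case: i => i /= ik; lia. Qed.

Definition posl (i : 'I_k.-1) : 'I_k := widen_ord (leq_pred k) i.
Definition posr (i : 'I_k.-1) : 'I_k := Ordinal (posr_subproof i).

Definition tsubst (s : tidx) (i : 'I_k.-1) (ab : 'I_N * 'I_N) : tidx :=
  [ffun j => if j == posl i then ab.1 else if j == posr i then ab.2 else s j].

(* Id^{\otimes i} \otimes T \otimes Id^{\otimes (k-i-2)} on the pure tensor s;  *)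
(* T ab cd is the coefficient of v_cd in the image of v_ab.                   *)
Definition tens_at (T : 'I_N * 'I_N -> {ffun 'I_N * 'I_N -> F^o})
    (i : 'I_k.-1) (s : tidx) : {ffun tidx -> F^o} :=
  \sum_(ab : 'I_N * 'I_N) T (s (posl i), s (posr i)) ab *: bvec F (tsubst s i ab).

Definition diag_tens (z : 'I_N -> F) (s : tidx) : {ffun tidx -> F^o} :=
  (\prod_(j < k) z (s j)) *: bvec F s.

Definition parity (a : 'I_N) : nat := (m <= a)%N.

Variable q : F.

Local Ltac split_pos := repeat (case: eqP => ?; try (exfalso; lia)); done.

Definition superT (ab : 'I_N * 'I_N) : {ffun 'I_N * 'I_N -> F^o} :=
  let: (a, b) := ab in
  if a == b then
    (((-1) ^+ parity a * (q + q^-1) + q - q^-1) / 2%:R) *: bvec F (a, b)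
  else if (a < b)%N then
    (-1) ^+ (parity a * parity b) *: bvec F (b, a) + (q - q^-1) *: bvec F (a, b)
  else (-1) ^+ (parity a * parity b) *: bvec F (b, a).

Definition superT_at (i : 'I_k.-1) : 'M[F]_#|tidx| := opmx (tens_at superT i).

Hypotheses (q_neq0 : q != 0) (two_neq0 : 2%:R != 0 :> F).

Let A (a b : 'I_N) : F := if a == b then (if (m <= a)%N then - q^-1 else q)
                        else if (a < b)%N then q - q^-1 else 0.
Let B (a b : 'I_N) : F := if a == b then 0
                        else (if (m <= a)%N && (m <= b)%N then -1 else 1).

Let superTE a b : superT (a, b) = A a b *: bvec F (a, b) + B a b *: bvec F (b, a).
Proof.
rewrite /superT /A /B /parity; case: eqP => [->|_].
  rewrite scale0r addr0; congr (_ *: _).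
  by case: leqP => _ /=; rewrite ?expr0 ?expr1; field; rewrite ?q_neq0 ?two_neq0.
have -> : (-1) ^+ ((m <= a)%N * (m <= b)%N) =
          (if (m <= a)%N && (m <= b)%N then -1 else 1) :> F.
  by case: (m <= a)%N; case: (m <= b)%N.
by case: ifP => _; rewrite ?scale0r ?add0r // addrC.
Qed.

Let swap (i : 'I_k.-1) (s : tidx) := tsubst s i (s (posr i), s (posl i)).

Let tens_atE i s : tens_at superT i s =
  A (s (posl i)) (s (posr i)) *: bvec F s +
  B (s (posl i)) (s (posr i)) *: bvec F (swap i s).
Proof.
rewrite /tens_at.
pose L (v : {ffun 'I_N * 'I_N -> F^o}) := \sum_ab v ab *: bvec F (tsubst s i ab).
have LD v w : L (v + w) = L v + L w.
  by rewrite /L -big_split; apply: eq_bigr => ab _; rewrite ffunE scalerDl.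
have LZ a v : L (a *: v) = a *: L v.
  by rewrite /L scaler_sumr; apply: eq_bigr => ab _; rewrite ffunE scalerA.
have Lb ab : L (bvec F ab) = bvec F (tsubst s i ab).
  rewrite /L (bigD1 ab) //= big1 => [|t /negPf ts]; rewrite ffunE ?ts ?scale0r //.
  by rewrite eqxx scale1r addr0.
rewrite -/(L _) superTE LD !LZ !Lb; congr (_ *: bvec F _ + _).
apply/ffunP=> j; rewrite ffunE /=; have [->//|_] := eqVneq j (posl i).
by have [->|] := eqVneq j (posr i).
Qed.

Let Tquad i s : lext (tens_at superT i) (tens_at superT i s) =
  (q - q^-1) *: tens_at superT i s + bvec F s.
Proof.
set l := posl i; set r := posr i.
have lr : (r == l) = false by rewrite -val_eqE /= (gtn_eqF (ltnSn _)).
have Sl : swap i s l = s r by rewrite ffunE eqxx.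
have Sr : swap i s r = s l by rewrite ffunE lr eqxx.
have SS : swap i (swap i s) = s.
  apply/ffunP=> j; rewrite !ffunE /= -/l -/r ?eqxx ?lr.
  by do 2![case: eqVneq => [->|_] //]; rewrite ?eqxx ?lr.
rewrite tens_atE lextD !lextZ !lext_bvec !tens_atE Sl Sr SS -/l -/r.
apply/ffunP=> u; rewrite !ffunE.
have sw0 : s l = s r -> swap i s = s.
  move=> slr; apply/ffunP=> j; rewrite !ffunE /= -/l -/r.
  by do 2![case: eqVneq => [->|_] //].
rewrite /A /B; case: (ltngtP (s l) (s r)) => [ab|ab|/val_inj e];
  [| |rewrite (sw0 e) e]; rewrite ?eqxx -?val_eqE /= ?(ltn_eqF ab) ?(gtn_eqF ab);
  repeat case: (leqP m _) => _ /=; rewrite /GRing.scale /=; field; exact: q_neq0.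
Qed.

Let Tcomm (i j : 'I_k.-1) s : (i.+1 < j)%N ->
  lext (tens_at superT i) (tens_at superT j s) =
  lext (tens_at superT j) (tens_at superT i s).
Proof.
move=> ij.
have sw t : [/\ swap i t (posl j) = t (posl j), swap i t (posr j) = t (posr j),
   swap j t (posl i) = t (posl i) & swap j t (posr i) = t (posr i)].
  by split; rewrite ffunE -!val_eqE /=; split_pos.
have swC : swap i (swap j s) = swap j (swap i s).
  have [e1 e2 e3 e4] := sw s.
  apply/ffunP=> x; rewrite [LHS]ffunE [RHS]ffunE /= e1 e2 e3 e4 !ffunE -!val_eqE /=.
  split_pos.
have [e1 e2 e3 e4] := sw s.
rewrite !tens_atE !lextD !lextZ !lext_bvec !tens_atE e1 e2 e3 e4 swC.
apply/ffunP=> u; rewrite !ffunE /GRing.scale /=; ring.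
Qed.

Let Tbraid (i j : 'I_k.-1) s : j = i.+1 :> nat ->
  lext (tens_at superT i) (lext (tens_at superT j) (tens_at superT i s)) =
  lext (tens_at superT j) (lext (tens_at superT i) (tens_at superT j s)).
Proof.
move=> ij.
pose S a b c : tidx := [ffun x : 'I_k => if val x == i then a else
  if val x == i.+1 then b else if val x == i.+2 then c else s x].
pose V a b c := bvec F (S a b c).
have Ti a b c : tens_at superT i (S a b c) = A a b *: V a b c + B a b *: V b a c.
  rewrite tens_atE !ffunE /= !eqxx (gtn_eqF (ltnSn _)).
  congr (_ + _ *: bvec F _); apply/ffunP=> x; rewrite !ffunE -!val_eqE /= !eqxx.
  rewrite (gtn_eqF (ltnSn _)); split_pos.
have Tj a b c : tens_at superT j (S a b c) = A b c *: V a b c + B b c *: V a c b.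
  have ne1 : (i.+1 == i :> nat) = false by lia.
  have ne2 : (i.+2 == i :> nat) = false by lia.
  have ne3 : (i.+2 == i.+1 :> nat) = false by lia.
  rewrite tens_atE !ffunE /= ij !eqxx ne1 ne2 ne3.
  congr (_ + _ *: bvec F _); apply/ffunP=> x; rewrite !ffunE -!val_eqE /= ij.
  rewrite !eqxx ne1 ne2 ne3.
  split_pos.
have -> : s = S (s (posl i)) (s (posr i)) (s (posr j)).
  apply/ffunP=> x; rewrite ffunE.
  case: eqP => [e|_]; first by congr (s _); apply: val_inj.
  case: eqP => [e|_]; first by congr (s _); apply: val_inj.
  by case: eqP => [e|_] //; congr (s _); apply: val_inj; rewrite /= ij.
move: (s (posl i)) (s (posr i)) (s (posr j)) => a b c.
rewrite !(Ti, Tj, lextD, lextZ, lext_bvec).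
apply/ffunP=> u; rewrite !ffunE.
pose W a b c : F := (u == S a b c)%:R.
rewrite -!/(W _ _ _); move: (W) => {}W; rewrite /GRing.scale /= /A /B -!val_eqE /=.
case: (ltngtP a b) => ab; case: (ltngtP b c) => bc; case: (ltngtP a c) => ac;
  try (exfalso; lia);
  repeat match goal with H : nat_of_ord _ = nat_of_ord _ |- _ =>
    move/val_inj: H => H; subst end;
  repeat case: (leqP m _) => _ /=; by field; rewrite ?q_neq0.
Qed.

Lemma superT_at_quad i : superT_at i *m superT_at i =
  (q - q^-1) *: superT_at i + 1%:M.
Proof.
by rewrite opmx_mul opmxZ -opmx1 opmxD; apply: eq_opmx => s; exact: Tquad.
Qed.

Lemma superT_at_comm (i j : 'I_k.-1) : (i.+1 < j)%N ->
  superT_at i *m superT_at j = superT_at j *m superT_at i.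
Proof.
by move=> ij; rewrite !opmx_mul; apply: eq_opmx => s; exact: Tcomm.
Qed.

Lemma superT_at_braid (i j : 'I_k.-1) : j = i.+1 :> nat ->
  superT_at i *m superT_at j *m superT_at i =
  superT_at j *m superT_at i *m superT_at j.
Proof.
move=> ij; rewrite -!mulmxA !opmx_mul; apply: eq_opmx => s; exact: Tbraid.
Qed.

Lemma superT_at_hecke s t : hecke_rel q s t ->
  aeval superT_at s = aeval superT_at t.
Proof.
case=> [i|i j ij|i j /orP[ij|ij]] /=.
- by rewrite superT_at_quad mul_scalar_mx.
- exact: superT_at_braid.
- exact: superT_at_comm.
- by rewrite -superT_at_comm.
Qed.

Definition super_rep : hecke q k -> 'M[F]_#|tidx| := plift superT_at_hecke.

HB.instance Definition _ := GRing.RMorphism.on super_rep.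
HB.instance Definition _ := GRing.Linear.on super_rep.

Lemma super_rep_gen i : super_rep (heckeT q i) = superT_at i.
Proof. exact: plift_gen. Qed.

End TensorPower.

(* Formal power series in u, as sequences of coefficients.                    *)
Section SupersymmetricQ.

Variable F : fieldType.

Definition fps_mul (f g : nat -> F) : nat -> F :=
  fun k => \sum_(i < k.+1) f i * g (k - i)%N.

Definition fps_one : nat -> F := fun k => (k == 0)%:R.

Definition fps_poly (p : {poly F}) : nat -> F := fun k => p`_k.

(* (1 - b u)^-1 = \sum_k b^k u^k *)
Definition fps_geom (b : F) : nat -> F := fun k => b ^+ k.

Lemma fps_geomP b : fps_mul (fps_poly (1 - b *: 'X)) (fps_geom b) = fps_one.
Proof.
have cE k : (1 - b *: 'X)`_k = (k == 0)%:R - b * (k == 1)%:R.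
  by rewrite coefB coefZ coefX coef1.
apply/funext=> -[|k]; rewrite /fps_mul /fps_poly /fps_geom /fps_one.
  by rewrite big_ord1 cE /= mulr0 subr0 mulr1.
rewrite big_ord_recl big_ord_recl big1 => [|i _]; rewrite !cE /=.
  by rewrite subSS !subn0 addr0 mulr0 mulr1 subr0 mul1r sub0r mulNr -exprS subrr.
by rewrite mulr0 subr0 mul0r.
Qed.

Variables (m n : nat) (q : F) (x : 'I_m -> F) (y : 'I_n -> F).

Definition superq_series : nat -> F :=
  fps_mul
    (\big[fps_mul/fps_one]_(i < m)
       fps_mul (fps_poly (1 - (x i * q) *: 'X)) (fps_geom (x i)))
    (\big[fps_mul/fps_one]_(j < n)
       fps_mul (fps_poly (1 - y j *: 'X)) (fps_geom (y j * q))).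

Definition superq (k : nat) : F := superq_series k.

End SupersymmetricQ.

Section GenericField.

Variables m n : nat.

Definition Kfield : fieldType := {fraction {mpoly {fraction {poly rat}}[m + n]}}.

Definition qK : Kfield := tofrac (mpolyC (m + n) (tofrac ('X : {poly rat}))).
Definition xK (i : 'I_m) : Kfield := tofrac ('X_(lshift n i)).
Definition yK (j : 'I_n) : Kfield := tofrac ('X_(rshift m j)).

Definition zK (a : 'I_(m + n)) : Kfield :=
  match split a with inl i => xK i | inr j => - yK j end.

Lemma qK_neq0 : qK != 0.
Proof.
by rewrite /qK tofrac_eq0 mpolyC_eq0 tofrac_eq0 polyX_eq0.
Qed.

Lemma two_neq0K : 2%:R != 0 :> Kfield.
Proof.
have two_frac (R : idomainType) : 2%:R != 0 :> R -> 2%:R != 0 :> {fraction R}.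
  by rewrite -(rmorph_nat (@tofrac R)) tofrac_eq0.
have two_mpoly (R : idomainType) : 2%:R != 0 :> R -> 2%:R != 0 :> {mpoly R[m + n]}.
  by rewrite -(rmorph_nat (@mpolyC (m + n) R)) mpolyC_eq0.
have two_poly : 2%:R != 0 :> {poly rat} by rewrite -polyC_natr polyC_eq0.
exact: two_frac (two_mpoly _ (two_frac _ two_poly)).
Qed.

Definition pi_k (k : nat) : hecke qK k -> 'M[Kfield]_#|{ffun 'I_k -> 'I_(m + n)}| :=
  @super_rep Kfield m n k qK qK_neq0 two_neq0K.

Definition D_k (k : nat) : 'M[Kfield]_#|{ffun 'I_k -> 'I_(m + n)}| :=
  opmx (diag_tens zK).

HB.instance Definition _ k := GRing.RMorphism.on (@pi_k k).
HB.instance Definition _ k := GRing.Linear.on (@pi_k k).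

End GenericField.

Arguments xK : clear implicits.
Arguments yK : clear implicits.
Arguments zK : clear implicits.
Arguments pi_k : clear implicits.

(* Main.v *)
Require Import Defs.
From HB Require Import structures.
From mathcomp Require Import all_boot all_order all_algebra.
From mathcomp Require Import mpoly boolp ring.

Set Implicit Arguments.
Unset Strict Implicit.
Unset Printing Implicit Defensive.

Import GRing.Theory.

Local Open Scope ring_scope.

(** The trace reduces to a generating function of weakly increasing words.

    Let d = q - q^-1. In T_1 T_2 ... T_(k-1) the factor T_(k-1) acts first, and
    it is the only one that touches the last tensor position; then T_(k-2) is
    the only remaining one that touches the next to last position, and so on.
    Hence, to come back to the basis tensor of a word s, each T_i has to leave
    the letter at position i+1 in place at once. The coefficient with which T
    does so on v_a (x) v_b is an eigenvalue of T (q or -q^-1) if a = b, it is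
    d if a < b, and 0 if a > b: the exchange term never contributes, because it
    moves a letter unless a = b. So the diagonal entry at s is a product of such
    weights over adjacent letters (prefix_diag), and only weakly increasing
    words count.

    Write lam_a for the eigenvalue at v_a. A weakly increasing word is a run of
    each letter a. A run of length r > 0 weighs z_a^r lam_a^(r-1), and every run
    after the first one brings a factor d. After multiplication by d the runs
    become independent, and for k > 0 the trace times d is the coefficient of
    u^k in the product over a of
      1 + sum_(r > 0) d z_a^r lam_a^(r-1) u^r
        = (1 - z_a (lam_a - d) u) / (1 - z_a lam_a u)
    (sum_increasing_words). Since lam_a - d is q^-1 for an even and -q for an
    odd letter, these factors are those of the series of q_k(x/y; q^-2) after
    the substitution of q u for u (superq_dilate). *)

(** * Formal power series *)

Section PowerSeries.

Variable F : fieldType.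
Implicit Types (f g h : nat -> F) (b c : F).

(** Below any given degree the convolution agrees with the product of truncated
    polynomials, which inherits associativity from the polynomial ring. *)
Lemma fps_mul_coef d f g k : (k < d)%N ->
  fps_mul f g k = ((\poly_(i < d) f i) * (\poly_(i < d) g i))`_k.
Proof.
move=> kd; rewrite coefM; apply: eq_bigr => i _.
rewrite !coef_poly (leq_ltn_trans (leq_subr _ _) kd).
by rewrite (leq_ltn_trans _ kd) // -ltnS.
Qed.

Fact fps_mulA : associative (@fps_mul F).
Proof.
move=> f g h; apply/funext=> k.
transitivity ((\poly_(i < k.+1) f i *
  (\poly_(i < k.+1) g i * \poly_(i < k.+1) h i))`_k).
  rewrite coefM; apply: eq_bigr => i _; rewrite coef_poly ltn_ord.
  by rewrite (@fps_mul_coef k.+1) // ltnS leq_subr.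
rewrite mulrA coefM; apply: eq_bigr => i _; rewrite coef_poly ltnS leq_subr.
by rewrite (@fps_mul_coef k.+1).
Qed.

Fact fps_mul1l : left_id (@fps_one F) (@fps_mul F).
Proof.
move=> f; apply/funext=> k; rewrite /fps_mul big_ord_recl big1 => [|i _].
  by rewrite /fps_one mul1r addr0 subn0.
by rewrite /fps_one mul0r.
Qed.

Fact fps_mul1r : right_id (@fps_one F) (@fps_mul F).
Proof.
move=> f; apply/funext=> k; rewrite /fps_mul big_ord_recr big1 /= => [|i _].
  by rewrite /fps_one subnn mulr1 add0r.
by rewrite /fps_one subn_eq0 leqNgt ltn_ord mulr0.
Qed.

HB.instance Definition _ :=
  Monoid.isLaw.Build (nat -> F) (@fps_one F) (@fps_mul F)
    fps_mulA fps_mul1l fps_mul1r.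

(** The rational function (1 - b u) / (1 - c u). *)
Definition fps_linfrac b c : nat -> F :=
  fps_mul (fps_poly (1 - b *: 'X)) (fps_geom c).

Lemma fps_linfrac0 b c : fps_linfrac b c 0 = 1.
Proof.
rewrite /fps_linfrac /fps_mul big_ord1 /fps_poly /fps_geom expr0 mulr1.
by rewrite coefB coef1 coefZ coefX mulr0 subr0.
Qed.

Lemma fps_linfracS b c k : fps_linfrac b c k.+1 = (c - b) * c ^+ k.
Proof.
have cE i : (1 - b *: 'X)`_i = (i == 0)%:R - b * (i == 1)%:R.
  by rewrite coefB coefZ coefX coef1.
rewrite /fps_linfrac /fps_mul /fps_poly /fps_geom big_ord_recl big_ord_recl.
rewrite big1 => [|i _]; rewrite !cE /=; last by rewrite mulr0 subr0 mul0r.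
by rewrite subSS !subn0 exprS; ring.
Qed.

(** The substitution of c u for u. *)
Definition fps_dilate c f : nat -> F := fun k => c ^+ k * f k.

Lemma fps_dilateM c : {morph fps_dilate c : f g / fps_mul f g}.
Proof.
move=> f g; apply/funext=> k; rewrite /fps_dilate /fps_mul mulr_sumr.
apply: eq_bigr => i _; have ik : (i <= k)%N by rewrite -ltnS.
by rewrite -{1}(subnKC ik) exprD mulrACA.
Qed.

Lemma fps_dilate1 c : fps_dilate c (@fps_one F) = @fps_one F.
Proof.
apply/funext=> -[|k]; rewrite /fps_dilate /fps_one ?mulr0 //.
by rewrite expr0 mul1r.
Qed.

Lemma fps_dilate_linfrac a b c :
  fps_dilate a (fps_linfrac b c) = fps_linfrac (a * b) (a * c).
Proof.
apply/funext=> -[|k]; rewrite /fps_dilate ?fps_linfrac0 ?mulr1 //.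
by rewrite !fps_linfracS exprS exprMn; ring.
Qed.

End PowerSeries.

(** * Sums over words by a transfer recursion *)

Section Words.

Variables (F : fieldType) (I : finType) (z : I -> F) (w : I -> I -> F).

(** The total weight of the words of length k + 1 that end in b, where each
    letter weighs z and each pair of adjacent letters weighs w. *)
Fixpoint last_sum (k : nat) (b : I) : F :=
  if k is k'.+1 then z b * \sum_a last_sum k' a * w a b else z b.

(** The test function phi of the last letter makes the induction go through:
    removing the last letter b turns the factor w a b into a test function of
    the new last letter a. *)
Lemma sum_words_last k (phi : I -> F) :
  \sum_(s : {ffun 'I_k.+1 -> I})
    (\prod_j z (s j)) *
    (\prod_(i < k) w (s (widen_ord (leqnSn k) i)) (s (lift ord0 i)))
    * phi (s ord_max) = \sum_b last_sum k b * phi b.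
Proof.
elim: k phi => [|k IHk] phi.
  rewrite (reindex (fun b : I => [ffun _ : 'I_1 => b])) /=; last first.
    exists (fun s : {ffun 'I_1 -> I} => s ord0) => [b|s] _; first by rewrite ffunE.
    by apply/ffunP=> i; rewrite ffunE (ord1 i).
  by apply: eq_bigr => b _; rewrite big_ord1 big_ord0 !ffunE mulr1.
pose ext (p : {ffun 'I_k.+1 -> I} * I) : {ffun 'I_k.+2 -> I} :=
  [ffun i => oapp p.1 p.2 (unlift ord_max i)].
have widenE i : widen_ord (leqnSn k.+1) i = lift ord_max i.
  by apply: val_inj; exact/esym/lift_max.
have extl p : ext p ord_max = p.2 by rewrite ffunE unlift_none.
have extw p i : ext p (widen_ord (leqnSn k.+1) i) = p.1 i.
  by rewrite widenE ffunE liftK.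
rewrite (reindex ext) /=; last first.
  exists (fun s => ([ffun i => s (widen_ord (leqnSn k.+1) i)], s ord_max)).
    move=> [s b] _; rewrite extl; congr (_, _).
    by apply/ffunP=> i; rewrite ffunE extw.
  move=> s _; apply/ffunP=> i; rewrite ffunE.
  by case: unliftP => [j ->|->] //=; rewrite ffunE widenE.
rewrite -(pair_bigA _ (fun s b => (\prod_j z (ext (s, b) j)) *
    (\prod_(i < k.+1) w (ext (s, b) (widen_ord (leqnSn k.+1) i))
                        (ext (s, b) (lift ord0 i)))
    * phi (ext (s, b) ord_max))) /= exchange_big /=.
apply: eq_bigr => b _.
rewrite -(IHk (w^~ b)) mulr_sumr mulr_suml; apply: eq_bigr => s _.
have -> : \prod_j z (ext (s, b) j) = (\prod_j z (s j)) * z b.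
  by rewrite big_ord_recr /= extl; under eq_bigr do rewrite extw.
have -> : \prod_(i < k.+1) w (ext (s, b) (widen_ord (leqnSn k.+1) i))
                             (ext (s, b) (lift ord0 i)) =
    (\prod_(i < k) w (s (widen_ord (leqnSn k) i)) (s (lift ord0 i)))
    * w (s ord_max) b.
  rewrite big_ord_recr /= extw; congr (_ * w _ _); last first.
    by rewrite (_ : lift ord0 ord_max = ord_max) ?extl //; exact: val_inj.
  apply: eq_bigr => i _; rewrite extw; congr (w _ _).
  by rewrite -[RHS](extw (s, b)); congr (ext _ _); exact: val_inj.
rewrite extl /=; ring.
Qed.

End Words.

Section IncreasingWords.

Variables (F : fieldType) (N : nat) (z lam : 'I_N -> F) (d : F).

Definition increasing_weight (a b : 'I_N) : F :=
  if a == b then lam a else if (a < b)%N then d else 0.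

Local Notation f := (last_sum z increasing_weight).

(** Coefficient of u^k in the generating series, scaled by d in positive degree,
    of the increasing words in the letters a < j. The constant term 1 is not d
    times the weight of the empty word: with it, the first run of a word obeys
    the same rule as the later ones. *)
Definition below_series (j k : nat) : F :=
  if k is k'.+1 then d * \sum_(a < N | (a < j)%N) f k' a else 1.

Lemma last_sum_increasingS k b :
  f k.+1 b = z b * lam b * f k b + z b * below_series b k.+1.
Proof.
rewrite /= (bigD1 b) //= /increasing_weight eqxx mulrDr; congr (_ + _).
  by ring.
congr (_ * _); rewrite mulr_sumr [RHS]big_mkcond [LHS]big_mkcond.
apply: eq_bigr => a _ /=; case: eqVneq => [->|ab] /=; first by rewrite ltnn.
by case: ifP => _; rewrite ?mulr0 // mulrC.
Qed.

(** Splitting an increasing word at the start of its last run: i letters below b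
    are followed by k - i + 1 copies of b. *)
Lemma last_sum_increasingE k b :
  f k b = \sum_(i < k.+1) below_series b i * (z b * (z b * lam b) ^+ (k - i)).
Proof.
elim: k => [|k IHk]; first by rewrite big_ord1 /= mul1r subnn expr0 mulr1.
rewrite last_sum_increasingS big_ord_recr /= subnn expr0 mulr1 IHk.
rewrite [_ * z b]mulrC; congr (_ + _); rewrite mulr_sumr; apply: eq_bigr => i _.
by rewrite subSn -1?ltnS // exprS; ring.
Qed.

Lemma below_seriesS (b : 'I_N) : below_series b.+1 =
  fps_mul (below_series b) (fps_linfrac (z b * (lam b - d)) (z b * lam b)).
Proof.
apply/funext=> -[|k].
  by rewrite /fps_mul big_ord1 fps_linfrac0 mulr1.
rewrite /fps_mul big_ord_recr /= subnn fps_linfrac0 mulr1.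
rewrite (bigD1 b) //= mulrDr; congr (_ + _); last first.
  congr (_ * _); apply: eq_bigl => a.
  by rewrite ltnS -val_eqE /= ltn_neqAle andbC.
rewrite last_sum_increasingE mulr_sumr; apply: eq_bigr => i _.
rewrite subSn -1?ltnS // fps_linfracS; ring.
Qed.

Lemma below_seriesE j (jN : (j <= N)%N) : below_series j =
  \big[@fps_mul F/@fps_one F]_(i < j)
    let b := widen_ord jN i in fps_linfrac (z b * (lam b - d)) (z b * lam b).
Proof.
elim: j jN => [|j IHj] jN.
  rewrite big_ord0; apply/funext=> -[|k] //=.
  by rewrite big_pred0 ?mulr0.
rewrite big_ord_recr /= -[j in LHS]/(val (widen_ord jN ord_max)) below_seriesS.
congr fps_mul; rewrite /= (IHj (ltnW jN)); apply: eq_bigr => i _ /=.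
have -> // : widen_ord jN (widen_ord (leqnSn j) i) = widen_ord (ltnW jN) i.
exact: val_inj.
Qed.

Lemma sum_increasing_words k :
  d * (\sum_(s : {ffun 'I_k.+1 -> 'I_N}) (\prod_j z (s j)) *
     \prod_(i < k)
       increasing_weight (s (widen_ord (leqnSn k) i)) (s (lift ord0 i)))
  = (\big[@fps_mul F/@fps_one F]_(b < N)
       fps_linfrac (z b * (lam b - d)) (z b * lam b)) k.+1.
Proof.
have -> : \big[@fps_mul F/@fps_one F]_(b < N)
       fps_linfrac (z b * (lam b - d)) (z b * lam b) = below_series N.
  rewrite (below_seriesE (leqnn N)); apply: eq_bigr => i _ /=.
  by have -> : widen_ord (leqnn N) i = i by apply: val_inj.
congr (_ * _).
have := sum_words_last z increasing_weight k (fun=> 1).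
rewrite (eq_bigr _ (fun s _ => mulr1 _)) => ->.
by apply: eq_big => [a|a _]; rewrite ?ltn_ord ?mulr1.
Qed.

End IncreasingWords.

(** * Diagonal entries of the Coxeter element *)

Section Diagonal.

Variables (F : fieldType) (m n : nat) (q : F).
Notation N := (m + n)%N.

(** The eigenvalue of T at v_a (x) v_a. *)
Definition superT_eigen (a : 'I_N) : F :=
  ((-1) ^+ parity a * (q + q^-1) + q - q^-1) / 2%:R.

Local Notation w := (increasing_weight superT_eigen (q - q^-1)).

(** If T keeps the right letter b, then it keeps the left one as well: the
    exchanged pair ends in b only if both letters are equal. *)
Lemma superT_keep_right (a b c : 'I_N) :
  superT q (a, b) (c, b) = (c == a)%:R * w a b.
Proof.
rewrite /superT /increasing_weight /superT_eigen; case: (eqVneq a b) => [->|ab].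
  by rewrite !ffunE xpair_eqE eqxx andbT [RHS]mulrC.
have cb : ((c, b) == (b, a)) = false.
  by rewrite xpair_eqE [b == a]eq_sym (negPf ab) andbF.
case: ifP => _; rewrite !ffunE cb ?xpair_eqE ?eqxx ?andbT /GRing.scale /=; ring.
Qed.

Section Position.

Variable k : nat.
Notation tidx := {ffun 'I_k -> 'I_N}.
Notation M i := (@superT_at F m n k q i).

Implicit Type T : 'I_N * 'I_N -> {ffun 'I_N * 'I_N -> F^o}.

Lemma tens_at_supp T (i : 'I_k.-1) (s t : tidx) : tens_at T i s t != 0 ->
  forall j, j != posl i -> j != posr i -> t j = s j.
Proof.
move=> nz j /negPf jl /negPf jr; apply/eqP; apply: contraNT nz => tj.
rewrite sum_ffunE big1 // => ab _; rewrite !ffunE; case: (eqVneq t) => [tE|_].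
  by rewrite tE ffunE jl jr eqxx in tj.
exact: mulr0.
Qed.

Lemma tens_at_agree T (i : 'I_k.-1) (s t : tidx) :
  (forall j, j != posl i -> j != posr i -> t j = s j) ->
  tens_at T i s t = T (s (posl i), s (posr i)) (t (posl i), t (posr i)).
Proof.
move=> ts; have rl : (posr i == posl i) = false.
  by rewrite -val_eqE /= (gtn_eqF (ltnSn _)).
rewrite sum_ffunE (bigD1 (t (posl i), t (posr i))) //= big1 => [|[a b] ab].
  rewrite !ffunE addr0 /GRing.scale /=.
  suff tE : t = tsubst s i (t (posl i), t (posr i)) by rewrite -tE eqxx mulr1.
  apply/ffunP=> j; rewrite ffunE; case: eqVneq => [-> //|jl].
  by case: eqVneq => [-> //|jr]; rewrite ts.
rewrite !ffunE; case: (eqVneq t) => [tE|_]; last by rewrite [LHS]mulr0.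
by case/eqP: ab; rewrite tE !ffunE /= rl !eqxx.
Qed.

Local Notation prefix j jk := (\prod_(i < j) M (widen_ord jk i)).

Lemma prefixS j (jk : (j < k.-1)%N) :
  prefix j.+1 jk = prefix j (ltnW jk) *m M (widen_ord jk ord_max).
Proof.
have widenE i : widen_ord jk (widen_ord (leqnSn j) i) = widen_ord (ltnW jk) i.
  exact: val_inj.
have -> : prefix j (ltnW jk) =
    \prod_(i < j) M (widen_ord jk (widen_ord (leqnSn j) i)).
  by apply: eq_bigr => i _; rewrite widenE.
exact: big_ord_recr.
Qed.

(** The first j generators act on positions 0, ..., j only. *)
Lemma prefix_fixes_right j (jk : (j <= k.-1)%N) r c : prefix j jk r c != 0 ->
  forall p : 'I_k, (j < p)%N -> enum_val r p = enum_val c p.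
Proof.
elim: j jk c => [|j IHj] jk c.
  by rewrite big_ord0 mxE; case: (eqVneq r c) => [->|]; rewrite ?eqxx.
rewrite prefixS mxE => nz p jp.
have /existsP[e] : [exists e,
    prefix j (ltnW jk) r e * M (widen_ord jk ord_max) e c != 0].
  apply: contraNT nz; rewrite negb_exists => /forallP z0; rewrite big1 // => e _.
  by have /negPn/eqP := z0 e.
rewrite mulf_eq0 negb_or mxE => /andP[re ec].
rewrite (IHj _ _ re p (ltnW jp)); apply: (tens_at_supp ec); rewrite -val_eqE /=.
  by rewrite gtn_eqF // ltnW.
by rewrite gtn_eqF.
Qed.

(** Let c be a word in the image of r under the last factor M l, with l = j. The
    other factors fix the positions beyond j, so c agrees with r there if they
    bring it back to r; and M l moves nothing but positions j and j + 1. So M l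
    keeps the right one of its two letters, hence the left one too, and c = r. *)
Lemma prefix_diag j (jk : (j <= k.-1)%N) r : prefix j jk r r =
  \prod_(i < j) w (enum_val r (posl (widen_ord jk i)))
                  (enum_val r (posr (widen_ord jk i))).
Proof.
elim: j jk => [|j IHj] jk; first by rewrite !big_ord0 mxE eqxx.
rewrite prefixS big_ord_recr /= mxE; set l := widen_ord jk ord_max.
have -> : \prod_(i < j)
      w (enum_val r (posl (widen_ord jk (widen_ord (leqnSn j) i))))
        (enum_val r (posr (widen_ord jk (widen_ord (leqnSn j) i)))) =
    prefix j (ltnW jk) r r.
  rewrite IHj; apply: eq_bigr => i _.
  by congr (w (enum_val r _) (enum_val r _)); apply: val_inj.
have key c : prefix j (ltnW jk) r c != 0 -> M l c r != 0 ->
    M l c r = (c == r)%:R * w (enum_val r (posl l)) (enum_val r (posr l)).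
  move=> rc; rewrite mxE => cr.
  have off := tens_at_supp cr; rewrite tens_at_agree //.
  have right (p : 'I_k) : (j < p)%N -> enum_val c p = enum_val r p.
    by move=> jp; rewrite (prefix_fixes_right rc).
  rewrite (right (posr l)) ?superT_keep_right //=.
  congr (_%:R * _); congr nat_of_bool.
  apply/eqP/eqP=> [cl|-> //]; apply: enum_val_inj; apply/ffunP=> p.
  have [->//|pl] := eqVneq p (posl l).
  by have [->|pr] := eqVneq p (posr l); [rewrite right /=|exact: off].
rewrite (bigD1 r) //= [X in _ + X]big1 => [|c cr].
  rewrite [LHS]addr0; have [->|rr] := eqVneq (prefix j (ltnW jk) r r) 0.
    by rewrite !mul0r.
  congr (_ * _); rewrite mxE tens_at_agree // superT_keep_right eqxx mul1r //.
have [->|rc] := eqVneq (prefix j (ltnW jk) r c) 0; first by rewrite mul0r.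
have [->|mc] := eqVneq (M l c r) 0; first by rewrite mulr0.
by rewrite key // (negPf cr) mul0r mulr0.
Qed.

End Position.

Lemma trace_diag_Coxeter k (z : 'I_N -> F) :
  \tr (opmx (@diag_tens F m n k.+1 z)
       *m \prod_(i < k) superT_at m n q (i : 'I_k.+1.-1)) =
  \sum_(s : {ffun 'I_k.+1 -> 'I_N}) (\prod_j z (s j)) *
     \prod_(i < k) w (s (widen_ord (leqnSn k) i)) (s (lift ord0 i)).
Proof.
rewrite /mxtrace [RHS](reindex_onto enum_val enum_rank) /=; last first.
  by move=> s _; rewrite enum_rankK.
apply: eq_big => [r|r _]; first by rewrite enum_valK eqxx.
rewrite mxE (bigD1 r) //= [X in _ + X]big1 => [|c cr].
  rewrite [LHS]addr0 mxE !ffunE eqxx; congr (_ * _); first by rewrite [LHS]mulr1.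
  transitivity ((\prod_(i < k.+1.-1)
    superT_at m n q (widen_ord (leqnn k.+1.-1) i)) r r).
    suff widenE i : widen_ord (leqnn k.+1.-1) i = i.
      by under [in RHS]eq_bigr do rewrite widenE.
    exact: val_inj.
  rewrite prefix_diag; apply: eq_bigr => i _.
  by congr (w (enum_val r _) (enum_val r _)); apply: val_inj.
rewrite mxE !ffunE (inj_eq enum_val_inj) eq_sym (negPf cr).
by rewrite [X in X * _]mulr0 mul0r.
Qed.

End Diagonal.

(** * The supersymmetric generating series *)

Section SupersymmetricSeries.

Variables (F : fieldType) (m n : nat) (q : F) (x : 'I_m -> F) (y : 'I_n -> F).
Hypotheses (q_neq0 : q != 0) (two_neq0 : 2%:R != 0 :> F).

Definition signed_var (a : 'I_(m + n)) : F :=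
  match split a with inl i => x i | inr j => - y j end.

Lemma superT_eigen_even (i : 'I_m) : superT_eigen q (lshift n i) = q.
Proof.
rewrite /superT_eigen /parity /= leqNgt ltn_ord expr0; field.
by rewrite q_neq0 two_neq0.
Qed.

Lemma superT_eigen_odd (j : 'I_n) : superT_eigen q (rshift m j) = - q^-1.
Proof.
rewrite /superT_eigen /parity /= leq_addr expr1; field.
by rewrite q_neq0 two_neq0.
Qed.

(** The even factors have c = x_i and b = x_i q^-2, the odd ones c = y_j q^-2
    and b = y_j; multiplying both by q gives z lam and z (lam - d). *)
Lemma superq_dilate k : q ^+ k * superq (q ^- 2) x y k =
  (\big[@fps_mul F/@fps_one F]_(b < m + n)
     fps_linfrac (signed_var b * (superT_eigen q b - (q - q^-1)))
                 (signed_var b * superT_eigen q b)) k.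
Proof.
rewrite -[LHS]/(fps_dilate q (superq_series _ _ _) k) /superq_series.
rewrite fps_dilateM !(big_morph _ (@fps_dilateM F q) (fps_dilate1 q)).
rewrite big_split_ord /=; congr (fps_mul _ _ k); apply: eq_bigr => i _.
  rewrite superT_eigen_even /signed_var (unsplitK (inl i)).
  rewrite -/(fps_linfrac _ _) fps_dilate_linfrac.
  by congr fps_linfrac; field; rewrite ?q_neq0.
rewrite superT_eigen_odd /signed_var (unsplitK (inr i)).
rewrite -/(fps_linfrac _ _) fps_dilate_linfrac.
by congr fps_linfrac; field; rewrite ?q_neq0.
Qed.

Lemma trace_superq k : q - q^-1 != 0 ->
  \tr (opmx (@diag_tens F m n k.+1 signed_var)
       *m \prod_(i < k) superT_at m n q (i : 'I_k.+1.-1)) =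
  q ^+ k.+1 / (q - q^-1) * superq (q ^- 2) x y k.+1.
Proof.
move=> d_neq0; rewrite mulrAC superq_dilate -sum_increasing_words.
by rewrite trace_diag_Coxeter mulrC mulKf.
Qed.

End SupersymmetricSeries.

(** * The generic parameter *)

Lemma qK_subV_neq0 m n : qK m n - (qK m n)^-1 != 0.
Proof.
have sq_frac (R : idomainType) (a : R) :
    a ^+ 2 - 1 != 0 -> (tofrac a) ^+ 2 - 1 != 0.
  by rewrite -rmorphXn -(rmorph1 (@tofrac R)) -rmorphB tofrac_eq0.
have sq_mpoly (R : idomainType) (a : R) :
    a ^+ 2 - 1 != 0 -> (mpolyC (m + n) a) ^+ 2 - 1 != 0.
  by rewrite -rmorphXn -(rmorph1 (@mpolyC (m + n) R)) -rmorphB mpolyC_eq0.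
have sq_X : 'X ^+ 2 - 1 != 0 :> {poly rat}.
  by rewrite -size_poly_eq0 -polyC1 size_XnsubC.
have: qK m n ^+ 2 - 1 != 0 by exact: sq_frac (sq_mpoly _ _ (sq_frac _ _ sq_X)).
apply: contraNneq => /subr0_eq qV.
by rewrite expr2 {1}qV mulVf ?qK_neq0 // subrr.
Qed.

Theorem theorem5p3 (m n k : nat) (mn_ge1 : (1 <= m + n)%N) (k_ge1 : (1 <= k)%N) :
  \tr (D_k m n k *m pi_k m n k (heckeT_gamma (qK m n) k)) =
  qK m n ^+ k / (qK m n - (qK m n)^-1)
    * superq (qK m n ^- 2) (xK m n) (yK m n) k.
Proof.
case: k k_ge1 => // k _.
rewrite -(trace_superq _ _ (qK_neq0 m n) (two_neq0K m n) _ (qK_subV_neq0 m n)).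
congr (\tr (_ *m _)); rewrite /heckeT_gamma rmorph_prod.
by apply: eq_bigr => i _; exact: super_rep_gen.
Qed.
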